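(* Let $R$ be a commutative ring and $(G,L)$ an $R$-network. If $\mathcal{U}_0(G,L,R)=0$, then there is an isomorphism of $R$-modules, natural in the $R$-module $M$, \[ \mathcal{U}_0(G,L,M)\cong\operatorname{Tor}_1^R(\Upsilon(G,L),M), \] and $\operatorname{Tor}_j^R(\Upsilon(G,L),M)=0$ for all $j>1$. If $\mathcal{U}_0(G,L,R)\neq0$, there is still a natural surjection $\mathcal{U}_0(G,L,M)\twoheadrightarrow\operatorname{Tor}_1^R(\Upsilon(G,L),M)$.
   Context: A graph is a countable, locally finite, undirected multigraph. $V$ is its vertex set and $E$ its set of oriented edges (each undirected edge gives two oriented edges $e$ and $\overline{e}$); $e_+$ and $e_-$ are the starting and ending vertices of $e$, and $\mathcal{E}(x)=\{e\in E: e_+=x\}$. A $\partial$-graph is a graph with a specified partition $V=V^\circ\sqcup\partial V$ into interior and boundary vertices. $RV$ and $RV^\circ\subseteq RV$ denote the free $R$-modules on $V$ and $V^\circ$. A generalized Laplacian for $G$ over $R$ is an $R$-linear map $L:RV\to RV$ of the form $Lx=d(x)x+\sum_{e\in\mathcal{E}(x)}w(e)(x-e_-)$ for $x\in V$, where $w:E\to R$ satisfies $w(\overline{e})=w(e)$ and $d:V\to R$ is any function. An $R$-network is a pair $(G,L)$ of a $\partial$-graph and a generalized Laplacian over $R$. For an $R$-module $M$ and $u:V\to M$, define $Lu:V\to M$ by $Lu(x)=d(x)u(x)+\sum_{e\in\mathcal{E}(x)}w(e)(u(x)-u(e_-))$. $\Upsilon(G,L)=RV/L(RV^\circ)$, and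 $\mathcal{U}_0(G,L,M)$ is the $R$-module of finitely supported $u:V\to M$ with $Lu\equiv0$ on all of $V$ and $u|_{\partial V}\equiv0$. *)

(* Defs.v *)
From HB Require Import structures.
From mathcomp Require Import all_boot all_order all_algebra finmap.
From mathcomp Require Import mathcomp_extra boolp classical_sets functions.
From mathcomp Require Import cardinality fsbigop.

Set Implicit Arguments.
Unset Strict Implicit.
Unset Printing Implicit Defensive.

Import GRing.Theory.

Local Open Scope classical_set_scope.
Local Open Scope ring_scope.
Local Open Scope quotient_scope.

Section Submodules.
Context {R : pzRingType} {V : lmodType R}.

Lemma submodN (S : submodClosed V) v : (- v \in S) = (v \in S).
Proof.
apply/idP/idP=> Sv; last by rewrite -scaleN1r rpredZ.
by rewrite -[v]opprK -scaleN1r rpredZ.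
Qed.

Lemma submodB (S : submodClosed V) : {in S &, forall u v, u - v \in S}.
Proof. by move=> u v Su Sv; rewrite rpredD ?submodN. Qed.

Record submod (S : submodClosed V) :=
  Submod { incl : V; _ : incl \in (S : {pred V}) }.

HB.instance Definition _ S := [isSub for @incl S].
HB.instance Definition _ S := [Choice of submod S by <:].
HB.instance Definition _ S := [SubChoice_isSubLmodule of submod S by <:].

Fact incl_linear S : linear (@incl S).
Proof. by move=> a u v; rewrite -[LHS]/(val _) linearP. Qed.

HB.instance Definition _ S :=
  GRing.isLinear.Build R (submod S) V _ (@incl S) (@incl_linear S).

Definition lspan (A : set V) : {pred V} := fun v =>
  `[< forall S : submodClosed V, (forall a, A a -> a \in S) -> v \in S >].

Fact lspan_closed A : submod_closed (lspan A).
Proof.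
split=> [|a u v /asboolP Au /asboolP Av]; apply/asboolP => S AS.
  exact: rpred0.
by rewrite rpredD ?rpredZ ?Au ?Av.
Qed.

HB.instance Definition _ A := GRing.isSubmodClosed.Build R V (lspan A) (lspan_closed A).

End Submodules.

Section KernelRange.
Context {R : pzRingType} {V W : lmodType R}.

Definition lkernel (f : {linear V -> W}) : {pred V} := fun v => f v == 0.

Fact lkernel_closed f : submod_closed (lkernel f).
Proof.
split=> [|a u v /eqP fu /eqP fv]; apply/eqP; first by rewrite linear0.
by rewrite linearP fu fv scaler0 addr0.
Qed.

HB.instance Definition _ f :=
  GRing.isSubmodClosed.Build R V (lkernel f) (lkernel_closed f).

Definition lrange (f : {linear V -> W}) : {pred W} := fun w =>
  `[< exists v, f v = w >].

Fact lrange_closed f : submod_closed (lrange f).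
Proof.
split=> [|a _ _ /asboolP[u <-] /asboolP[v <-]]; apply/asboolP.
  by exists 0; rewrite linear0.
by exists (a *: u + v); rewrite linearP.
Qed.

HB.instance Definition _ f :=
  GRing.isSubmodClosed.Build R W (lrange f) (lrange_closed f).

End KernelRange.

Section Quotient.
Context {R : pzRingType} {V : lmodType R}.
Variable S : submodClosed V.

Definition lquot_rel (u v : V) := u - v \in S.

Fact lquot_relP : equiv_class_of lquot_rel.
Proof.
split=> [u|u v|v u w]; rewrite /lquot_rel ?subrr ?rpred0//.
  by rewrite -opprB submodN.
by move=> uv vw; rewrite -(subrKA v) rpredD.
Qed.

Canonical lquot_equiv := EquivRelPack lquot_relP.
Canonical lquot_encModRel := defaultEncModRel lquot_rel.

Definition lquot := {eq_quot lquot_rel}.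
HB.instance Definition _ := Choice.on lquot.
HB.instance Definition _ := EqQuotient.on lquot.

Definition lproj (v : V) : lquot := \pi v.

Lemma lprojE u v : (lproj u = lproj v) <-> (u - v \in S).
Proof. by split=> [/eqmodP//|uv]; exact/eqmodP. Qed.

Lemma lproj_repr q : lproj (repr q) = q.
Proof. exact: reprK. Qed.

Let zero : lquot := lproj 0.
Let opp (q : lquot) : lquot := lproj (- repr q).
Let add (q r : lquot) : lquot := lproj (repr q + repr r).
Let scale (a : R) (q : lquot) : lquot := lproj (a *: repr q).

Let reprP v : repr (lproj v) - v \in S.
Proof. by apply/lprojE; rewrite lproj_repr. Qed.

Let addE u v : add (lproj u) (lproj v) = lproj (u + v).
Proof. by apply/lprojE; rewrite opprD addrACA rpredD. Qed.

Let oppE u : opp (lproj u) = lproj (- u).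
Proof. by apply/lprojE; rewrite -opprD submodN. Qed.

Let scaleE a u : scale a (lproj u) = lproj (a *: u).
Proof. by apply/lprojE; rewrite -scalerBr rpredZ. Qed.

Let addA : associative add.
Proof.
move=> p q r; rewrite -[p]lproj_repr -[q]lproj_repr -[r]lproj_repr.
by rewrite !addE addrA.
Qed.

Let addC : commutative add.
Proof. by move=> p q; rewrite /add addrC. Qed.

Let add0 : left_id zero add.
Proof. by move=> p; rewrite -[p]lproj_repr addE add0r. Qed.

Let addN : left_inverse zero opp add.
Proof. by move=> p; rewrite -[p]lproj_repr oppE addE addNr. Qed.

HB.instance Definition _ := GRing.isZmodule.Build lquot addA addC add0 addN.

Let scaleA a b p : scale a (scale b p) = scale (a * b) p.
Proof. by rewrite -[p]lproj_repr !scaleE scalerA. Qed.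

Let scale1 : left_id 1 scale.
Proof. by move=> p; rewrite -[p]lproj_repr scaleE scale1r. Qed.

Let scaleDr : right_distributive scale +%R.
Proof.
move=> a p q; rewrite -[p]lproj_repr -[q]lproj_repr.
by rewrite [_ + _]addE !scaleE [RHS]addE scalerDr.
Qed.

Let scaleDl p : {morph scale^~ p : a b / a + b}.
Proof.
by move=> a b; rewrite -[p]lproj_repr !scaleE [RHS]addE scalerDl.
Qed.

HB.instance Definition _ := GRing.Zmodule_isLmodule.Build R lquot
  scaleA scale1 scaleDr scaleDl.

Fact lproj_linear : linear lproj.
Proof. by move=> a u v; rewrite [a *: lproj u]scaleE [RHS]addE. Qed.

HB.instance Definition _ := GRing.isLinear.Build R V lquot _ lproj lproj_linear.

End Quotient.

Arguments lproj {R V} S v.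

Section QuotientLift.
Context {R : pzRingType} {V W : lmodType R}.
Variables (S : submodClosed V) (f : {linear V -> W}).
Hypothesis fS : forall v, v \in S -> f v = 0.

Definition lquot_lift of (forall v, v \in S -> f v = 0) :=
  fun q : lquot S => f (repr q).

Lemma lquot_liftE v : lquot_lift fS (lproj S v) = f v.
Proof.
by apply/eqP; rewrite -subr_eq0 -linearB fS//; apply/lprojE; exact: lproj_repr.
Qed.

Fact lquot_lift_linear : linear (lquot_lift fS).
Proof.
move=> a p q; rewrite -[p]lproj_repr -[q]lproj_repr -linearP.
by rewrite !lquot_liftE linearP.
Qed.

HB.instance Definition _ :=
  GRing.isLinear.Build R (lquot S) W _ (lquot_lift fS) lquot_lift_linear.

End QuotientLift.

Section FiniteSupport.
Context {R : pzRingType} (T : Type) (M : lmodType R).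

Definition fin_supp : {pred T -> M} := fun u => `[< finite_set [set x | u x <> 0] >].

Fact fin_supp_closed : submod_closed fin_supp.
Proof.
split=> [|a u v /asboolP fu /asboolP fv]; apply/asboolP.
  by rewrite (_ : mkset _ = set0)//; apply/seteqP; split=> // x; apply.
apply: (@sub_finite_set _ _ ([set x | u x <> 0] `|` [set x | v x <> 0])).
  move=> x /= uvx; apply: contrapT => /not_orP[/contrapT ux /contrapT vx]; apply: uvx.
  by rewrite -[LHS]/(a *: u x + v x) ux vx scaler0 addr0.
by rewrite finite_setU.
Qed.

HB.instance Definition _ :=
  GRing.isSubmodClosed.Build R (T -> M) fin_supp fin_supp_closed.

End FiniteSupport.

Arguments fin_supp {R} T M _.

Section FreeModule.
Context (R : pzRingType) (T : choiceType).

Definition free : lmodType R := submod (fin_supp T R^o).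

Definition coef (u : free) (x : T) : R := incl u x.


Lemma free_inj (u v : free) : coef u =1 coef v -> u = v.
Proof. by move=> uv; apply: val_inj; apply/funext. Qed.

Lemma coef0 x : coef 0 x = 0.
Proof. by rewrite /coef linear0. Qed.

Lemma coefD u v x : coef (u + v) x = coef u x + coef v x.
Proof. by rewrite /coef linearD. Qed.

Lemma coefZ a u x : coef (a *: u) x = a * coef u x.
Proof. by rewrite /coef linearZ. Qed.

Fact delta_fin_supp (x : T) :
  (fun y => (y == x)%:R : R^o) \in (fin_supp T R^o : {pred _}).
Proof.
apply/asboolP/(@sub_finite_set _ _ [set x]); last exact: finite_set1.
by move=> y /=; case: eqP.
Qed.

Definition fdelta (x : T) : free := Submod (delta_fin_supp x).

Lemma coef_delta x y : coef (fdelta x) y = (y == x)%:R.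
Proof. by []. Qed.

Context {N : lmodType R}.

(* The linear map with prescribed values on the basis; the sum has finite
   support, as u does. *)
Definition lin_ext (g : T -> N) (u : free) : N :=
  \sum_(x \in [set: T]) coef u x *: g x.

Lemma free_finite (u : free) : finite_set [set x | coef u x <> 0].
Proof. by case: u => u u_fin; exact: (asboolP _ u_fin). Qed.

Fact lin_ext_linear g : linear (lin_ext g).
Proof.
move=> a u v; rewrite /lin_ext.
pose S := fset_set ([set x | coef u x <> 0] `|` [set x | coef v x <> 0]).
have Sfin : finite_set ([set x | coef u x <> 0] `|` [set x | coef v x <> 0]).
  by rewrite finite_setU; split; exact: free_finite.
have notS x : x \notin S -> coef u x = 0 /\ coef v x = 0.
  rewrite in_fset_set// notin_setE /= => /not_orP[].
  by move=> /contrapT ? /contrapT.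
rewrite !(@fsbigTE _ _ _ _ S).
- rewrite scaler_sumr -big_split; apply: eq_bigr => x _.
  by rewrite coefD coefZ scalerDl -scalerA.
- by move=> x /notS[_ ->]; rewrite scale0r.
- by move=> x /notS[-> _]; rewrite scale0r.
- by move=> x /notS[ux vx]; rewrite coefD coefZ ux vx mulr0 addr0 scale0r.
Qed.

HB.instance Definition _ g :=
  GRing.isLinear.Build R free N _ (lin_ext g) (lin_ext_linear g).

Lemma lin_ext_delta g x : lin_ext g (fdelta x) = g x.
Proof.
rewrite /lin_ext (@fsbigTE _ _ _ _ [fset x]%fset) ?big_seq_fset1.
  by rewrite coef_delta eqxx scale1r.
by move=> y; rewrite inE coef_delta => /negPf ->; rewrite scale0r.
Qed.

End FreeModule.

Arguments fdelta R {T} x.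
Arguments coef : simpl never.

Lemma free_ext {R : pzRingType} {T : choiceType} {N : lmodType R}
    (f g : {linear free R T -> N}) :
  (forall x, f (fdelta R x) = g (fdelta R x)) -> f =1 g.
Proof.
move=> fg u; suff -> : u = lin_ext (@fdelta R T) u.
  rewrite /lin_ext !linear_sum; apply: eq_bigr => x _.
  by rewrite !linearZ_LR fg.
apply: free_inj => y; rewrite /lin_ext.
rewrite (@fsbigTE _ _ _ _ (fset_set [set x | coef u x <> 0])).
  rewrite (big_morph (fun w => coef w y) (fun a b => coefD a b y) (coef0 R y)).
  under eq_bigr => x _ do rewrite coefZ coef_delta.
  have [yu|yu] := boolP (y \in fset_set [set x | coef u x <> 0]).
    rewrite (bigD1_seq y)//= big1 ?addr0 => [|x xy]; first by rewrite eqxx mulr1.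
    by rewrite eq_sym (negPf xy) mulr0.
  rewrite big_seq big1 => [|x xu].
    move: yu; rewrite in_fset_set ?notin_setE; last exact: free_finite.
    by move=> /= /contrapT.
  have [yx|] := eqVneq y x; first by rewrite yx xu in yu.
  by rewrite mulr0.
move=> x; rewrite in_fset_set ?notin_setE; last exact: free_finite.
by move=> /= /contrapT ->; rewrite scale0r.
Qed.

Section Tensor.
Context {R : comPzRingType}.

Definition bilinear_rel (A M : lmodType R) : set (free R (A * M)%type) :=
  [set t | [\/ exists a a' m,
                 t = fdelta R (a + a', m) - fdelta R (a, m) - fdelta R (a', m),
               exists a m m',
                 t = fdelta R (a, m + m') - fdelta R (a, m) - fdelta R (a, m'),
               exists r a m, t = fdelta R (r *: a, m) - r *: fdelta R (a, m) |
               exists r a m, t = fdelta R (a, r *: m) - r *: fdelta R (a, m)]].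

Arguments bilinear_rel A M _ : clear implicits.

Definition tensor (A M : lmodType R) : lmodType R := lquot (lspan (bilinear_rel A M)).

Definition tens {A M : lmodType R} (a : A) (m : M) : tensor A M :=
  lproj (lspan (bilinear_rel A M)) (fdelta R (a, m)).

Section Bilinearity.
Context {A M : lmodType R}.

Let bilinear_relE t t' : bilinear_rel A M (t - t') ->
  lproj (lspan (bilinear_rel A M)) t = lproj (lspan (bilinear_rel A M)) t'.
Proof. by move=> tt'; apply/lprojE/asboolP => S; exact. Qed.

Lemma tensDl (a a' : A) (m : M) : tens (a + a') m = tens a m + tens a' m.
Proof.
rewrite /tens -linearD; apply: bilinear_relE.
by apply: Or41; exists a, a', m; rewrite opprD addrA.
Qed.

Lemma tensDr (a : A) (m m' : M) : tens a (m + m') = tens a m + tens a m'.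
Proof.
rewrite /tens -linearD; apply: bilinear_relE.
by apply: Or42; exists a, m, m'; rewrite opprD addrA.
Qed.

Lemma tensZl r (a : A) (m : M) : tens (r *: a) m = r *: tens a m.
Proof.
by rewrite /tens -linearZ; apply: bilinear_relE; apply: Or43; exists r, a, m.
Qed.

Lemma tensZr r (a : A) (m : M) : tens a (r *: m) = r *: tens a m.
Proof.
by rewrite /tens -linearZ; apply: bilinear_relE; apply: Or44; exists r, a, m.
Qed.

End Bilinearity.

Section TensorMap.
Context {A B M N : lmodType R} (f : {linear A -> B}) (g : {linear M -> N}).

Let h : {linear free R (A * M)%type -> tensor B N} :=
  lin_ext (fun p : A * M => tens (f p.1) (g p.2)).

Fact tensor_map_subproof t : t \in lspan (bilinear_rel A M) -> h t = 0.
Proof.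
move=> /asboolP/(_ (lkernel h)) ht; apply/eqP/ht => _ [] [x [y [z ->]]];
  apply/eqP; rewrite ?linearB ?linearZ /= !lin_ext_delta /=.
- by rewrite linearD tensDl addrAC addrK subrr.
- by rewrite linearD tensDr addrAC addrK subrr.
- by rewrite linearZ tensZl scalerN subrr.
- by rewrite linearZ tensZr scalerN subrr.
Qed.

Definition tensor_map : {linear tensor A M -> tensor B N} :=
  lquot_lift tensor_map_subproof.

Lemma tensor_mapE a m : tensor_map (tens a m) = tens (f a) (g m).
Proof. exact: etrans (lquot_liftE _ _) (lin_ext_delta _ _). Qed.

End TensorMap.

Lemma tensor_ext (A M N : lmodType R) (f g : {linear tensor A M -> N}) :
  (forall a m, f (tens a m) = g (tens a m)) -> f =1 g.
Proof.
move=> fg q; rewrite -[q]lproj_repr; move: (repr q) => t.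
by apply: (@free_ext _ _ _ (f \o lproj _) (g \o lproj _)) => -[a m] /=; exact: fg.
Qed.

End Tensor.

Arguments tens : simpl never.
Arguments tensor_map : simpl never.

Section Homology.
Context {R : pzRingType} {U V W : lmodType R}.

Definition boundaries (f : {linear U -> V}) (g : {linear V -> W}) :
  {pred submod (lkernel g)} := fun z => incl z \in lrange f.

Arguments boundaries f g _ : clear implicits.

Fact boundaries_closed f g : submod_closed (boundaries f g).
Proof.
split=> [|a u v fu fv]; rewrite -topredE /= /boundaries ?linear0 ?rpred0//.
by rewrite linearP rpredD ?rpredZ.
Qed.

HB.instance Definition _ f g :=
  GRing.isSubmodClosed.Build R _ (boundaries f g) (boundaries_closed f g).

(* ker g / im f *)
Definition homology (f : {linear U -> V}) (g : {linear V -> W}) : lmodType R :=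
  lquot (boundaries f g).

End Homology.

Arguments boundaries {R U V W} f g _.

Section HomologyMap.
Context {R : pzRingType} {U V W U' V' W' : lmodType R}.
Variables (f : {linear U -> V}) (g : {linear V -> W}).
Variables (f' : {linear U' -> V'}) (g' : {linear V' -> W'}).
Variables (hU : {linear U -> U'}) (hV : {linear V -> V'}) (hW : {linear W -> W'}).
Hypothesis hf : forall u, hV (f u) = f' (hU u).
Hypothesis hg : forall v, hW (g v) = g' (hV v).

Fact cycle_map_subproof (z : submod (lkernel g)) : hV (incl z) \in lkernel g'.
Proof. by case: z => v /= /eqP gv; apply/eqP; rewrite -hg gv linear0. Qed.

Definition cycle_map (z : submod (lkernel g)) : submod (lkernel g') :=
  Submod (cycle_map_subproof z).

Fact cycle_map_linear : linear cycle_map.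
Proof. by move=> a u v; apply: val_inj; rewrite /= !linearP. Qed.

HB.instance Definition _ :=
  GRing.isLinear.Build R _ _ _ cycle_map cycle_map_linear.

Fact homology_map_subproof z : z \in boundaries f g ->
  (lproj (boundaries f' g') \o cycle_map) z = 0.
Proof.
move=> /asboolP[u fu] /=; rewrite -(linear0 (lproj (boundaries f' g'))).
apply/lprojE; rewrite subr0; apply/asboolP; exists (hU u) => /=.
by rewrite -hf fu.
Qed.

Definition homology_map : {linear homology f g -> homology f' g'} :=
  lquot_lift homology_map_subproof.

End HomologyMap.

Section Tor.
Context {R : comPzRingType}.

Definition augment (A : lmodType R) : {linear free R A -> A} := lin_ext id.

(* The canonical free resolution of A: the n-th module is free on the
   underlying set of the n-th syzygy, and the (n+1)-st syzygy is the kernel of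
   the evaluation map from it to the n-th syzygy. *)
Fixpoint syzygy (A : lmodType R) (n : nat) : lmodType R :=
  if n is m.+1 then submod (lkernel (augment (syzygy A m))) else A.

Definition res (A : lmodType R) (n : nat) : lmodType R := free R (syzygy A n).

Definition res_d (A : lmodType R) (n : nat) : {linear res A n.+1 -> res A n} :=
  @incl _ _ (lkernel (augment (syzygy A n))) \o augment (syzygy A n.+1).

Lemma augment_surj (A : lmodType R) (a : A) : exists u, augment A u = a.
Proof. by exists (fdelta R a); exact: lin_ext_delta. Qed.

Let res_d_range (A : lmodType R) n u :
  (u \in lrange (res_d A n)) = (u \in lkernel (augment (syzygy A n))).
Proof.
apply/asboolP/idP => [[v <-] | Ku]; last first.
  by have [v vE] := augment_surj (Submod Ku : syzygy A n.+1); exists v; rewrite /= vE.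
exact: (valP (augment (syzygy A n.+1) v : submod (lkernel (augment (syzygy A n))))).
Qed.

Lemma res_exact0 (A : lmodType R) : lrange (res_d A 0) =i lkernel (augment A).
Proof. exact: res_d_range. Qed.

Lemma res_exact (A : lmodType R) n : lrange (res_d A n.+1) =i lkernel (res_d A n).
Proof.
move=> u; rewrite res_d_range; apply/eqP/eqP => [/= -> | du]; first exact: linear0.
by apply: val_inj; rewrite [LHS]du [RHS]linear0.
Qed.

(* The differential of the complex res A (x) M *)
Definition chain_d (A M : lmodType R) (n : nat) :
    {linear tensor (res A n) M -> tensor (res A n.-1) M} :=
  if n is m.+1 then tensor_map (res_d A m) idfun else \0.

Definition Tor (n : nat) (A M : lmodType R) : lmodType R :=
  homology (chain_d A M n.+1) (chain_d A M n).

Fact chain_map_subproof (n : nat) (A M N : lmodType R) (f : {linear M -> N}) t :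
  tensor_map idfun f (chain_d A M n t) = chain_d A N n (tensor_map idfun f t).
Proof.
case: n t => [|n] t; first exact: linear0.
apply: (tensor_ext (f := tensor_map idfun f \o tensor_map (res_d A n) idfun)
                   (g := tensor_map (res_d A n) idfun \o tensor_map idfun f)).
move=> a m; rewrite -[LHS]/(tensor_map _ _ (tensor_map _ _ _)).
by rewrite -[RHS]/(tensor_map _ _ (tensor_map _ _ _)) !tensor_mapE.
Qed.

Definition Tor_map (n : nat) (A M N : lmodType R) (f : {linear M -> N}) :
    {linear Tor n A M -> Tor n A N} :=
  homology_map (@chain_map_subproof n.+1 A M N f) (@chain_map_subproof n A M N f).

End Tor.

(* Oriented multigraphs with edge reversal: source e is e_+, target e is e_-.
   By rev_neq, a loop also gives two distinct oriented edges. *)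
Record graph := Graph {
  vertex : countType;
  edge : countType;
  source : edge -> vertex;
  target : edge -> vertex;
  rev : edge -> edge;
  revK : involutive rev;
  rev_neq : forall e, rev e <> e;
  source_rev : forall e, source (rev e) = target e;
  locally_finite : forall x, finite_set [set e | source e = x] }.

Definition out (G : graph) (x : vertex G) : set (edge G) := [set e | source e = x].

Record bd_graph := BdGraph {
  bd_graph_graph :> graph;
  inner : set (vertex bd_graph_graph) }.

Definition boundary (G : bd_graph) : set (vertex G) := ~` @inner G.

(* The generalized Laplacian is given by its edge weights w and its diagonal
   part d, called potential. *)
Record network (R : comPzRingType) := Network {
  network_graph :> bd_graph;
  weight : edge network_graph -> R;
  weight_rev : forall e, weight (rev e) = weight e;
  potential : vertex network_graph -> R }.

Section Network.
Context {R : comPzRingType} (G : network R).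

Definition RV : lmodType R := free R (vertex G).

(* The free module on the interior vertices, seen inside RV *)
Definition RV_inner : {pred RV} := fun u =>
  `[< forall x, boundary x -> coef u x = 0 >].

Fact RV_inner_closed : submod_closed RV_inner.
Proof.
split=> [|a u v /asboolP u0 /asboolP v0]; apply/asboolP => x bx.
  exact: coef0.
by rewrite coefD coefZ u0// v0// mulr0 addr0.
Qed.

HB.instance Definition _ :=
  GRing.isSubmodClosed.Build R RV RV_inner RV_inner_closed.

Definition laplacian : {linear RV -> RV} :=
  lin_ext (fun x : vertex G => potential x *: fdelta R x
    + \sum_(e \in out x) weight e *: (fdelta R x - fdelta R (target e))).

Definition Upsilon : lmodType R :=
  lquot (lrange (laplacian \o @incl _ _ RV_inner)).

Section Functions.
Context (M : lmodType R).

Definition laplacian_fun (u : vertex G -> M) (x : vertex G) : M :=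
  potential x *: u x + \sum_(e \in out x) weight e *: (u x - u (target e)).

Lemma laplacian_funP a (u v : vertex G -> M) x :
  laplacian_fun (a *: u + v) x = a *: laplacian_fun u x + laplacian_fun v x.
Proof.
rewrite /laplacian_fun !(fsbig_finite _ _ (@locally_finite G x)).
rewrite [a *: (_ + _)]scalerDr scaler_sumr addrACA -big_split; congr (_ + _).
  rewrite -[(a *: u + v) x]/(a *: u x + v x) scalerDr !scalerA.
  by rewrite [_ * a]GRing.mulrC.
apply: eq_bigr => e _ /=; rewrite scalerA [a * _]GRing.mulrC -scalerA -scalerDr.
congr (_ *: _); rewrite -![(a *: u + v) _]/(a *: u _ + v _).
by rewrite opprD addrACA -scalerBr.
Qed.

Definition U0_pred : {pred vertex G -> M} := fun u =>
  `[< [/\ finite_set [set x | u x <> 0],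
          forall x, laplacian_fun u x = 0 &
          forall x, boundary x -> u x = 0] >].

Fact U0_closed : submod_closed U0_pred.
Proof.
split=> [|a u v /asboolP[uf Lu ub] /asboolP[vf Lv vb]]; apply/asboolP; split=> //.
- exact: asboolW (rpred0 (fin_supp _ M)).
- move=> x; rewrite /laplacian_fun fsbig1 ?scaler0 ?addr0// => e _.
  by rewrite subr0 scaler0.
- by apply: asboolW; apply: (proj2 (@fin_supp_closed _ _ M)); exact: asboolT.
- by move=> x; rewrite laplacian_funP Lu Lv scaler0 addr0.
- move=> x bx; rewrite -[LHS]/(a *: u x + v x) ub// vb//.
  by rewrite scaler0 addr0.
Qed.

HB.instance Definition _ :=
  GRing.isSubmodClosed.Build R (vertex G -> M) U0_pred U0_closed.

Definition U0 : lmodType R := submod U0_pred.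

End Functions.
End Network.

Section NetworkMap.
Context {R : comPzRingType} (G : network R) {M N : lmodType R}.
Variable f : {linear M -> N}.

Fact U0_map_subproof (u : U0 G M) : f \o incl u \in U0_pred (G := G) (M := N).
Proof.
case: u => u /= /asboolP[ufin Lu ub]; apply/asboolP; split=> [|x|x bx] /=.
- apply: sub_finite_set ufin => x /= fux ux.
  by apply: fux; rewrite ux linear0.
- rewrite -(linear0 f) -(Lu x) /laplacian_fun.
  rewrite !(fsbig_finite _ _ (@locally_finite G x)) linearD linear_sum linearZ.
  congr (_ + _); apply: eq_bigr => e _ /=.
  by rewrite -linearB -linearZ.
- by rewrite ub// linear0.
Qed.

Definition U0_map (u : U0 G M) : U0 G N := Submod (U0_map_subproof u).

Fact U0_map_linear : linear U0_map.
Proof. by move=> a u v; apply: val_inj; apply/funext => x; rewrite /= linearP. Qed.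

HB.instance Definition _ :=
  GRing.isLinear.Build R (U0 G M) (U0 G N) _ U0_map U0_map_linear.

End NetworkMap.

(* Main.v *)
From HB Require Import structures.
From mathcomp Require Import all_boot all_order all_algebra finmap.
From mathcomp Require Import boolp classical_sets functions cardinality fsbigop.
Require Import Defs.

(** Write [A] for the cokernel [lquot (lrange d)] of a linear map
[d : P -> Q] between projective modules.  The two-term complex [P -> Q] is a
resolution of [A] except that [d] may have a kernel, and it can be compared
with the canonical free resolution [res A]: lifting the identity of [A] gives
maps from [P -> Q] to [res A] and back, together with a homotopy [hpy0],
[hpy1] from the identity of [res A] to the round trip ([comparison_exists]).
All these maps can be tensored with [M].

- The comparison map sends the kernel of [d (x) M] to [Tor 1 A M]
  ([tor1_map]).  The homotopy shows that a cycle [z] of [res A (x) M] in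
  degree 1 differs by a boundary from the image of the element obtained by
  moving [z] back to [P (x) M], so that this map is surjective, whether or not
  [d] is injective ([tor1_map_surj]).
- If [d] is injective, then the backward map kills boundaries and the round
  trip on [P] is the identity up to a term factoring through [d], so that the
  map is also injective ([tor1_map_inj]).  Moreover the homotopy extends to all
  higher degrees, where the round trip is zero, so that the higher Tor modules
  vanish ([higher_tor_eq0]).

For a network, take for [d] the restriction of the Laplacian to the module of
the interior vertices, which is projective as a retract of the free module on
all vertices.  A tensor product with a free module consists of finitely
supported functions ([coords], [of_coords]), and through this identification
the Laplacian on the free module becomes the Laplacian on functions, because
the edge weights are symmetric ([coords_laplacian]).  Hence the kernel of
[d (x) M] is [U0 G M], naturally in [M] ([U0_kernel]), and for [M = R] the
vanishing of [U0] is the injectivity of [d] ([inner_laplacian_inj]). *)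

Set Implicit Arguments.
Unset Strict Implicit.
Unset Printing Implicit Defensive.

Import GRing.Theory.

Local Open Scope classical_set_scope.
Local Open Scope ring_scope.

(** * Kernels, ranges and projective modules *)

Section KernelRange.
Context {R : pzRingType} {V W : lmodType R} (f : {linear V -> W}).

Lemma lkernelP v : reflect (f v = 0) (v \in lkernel f).
Proof. exact: eqP. Qed.

Lemma lrangeP w : reflect (exists v, f v = w) (w \in lrange f).
Proof. exact: asboolP. Qed.

End KernelRange.

Lemma lproj_eq0 {R : pzRingType} {V : lmodType R} (S : submodClosed V) (v : V) :
  lproj S v = 0 <-> v \in S.
Proof. by rewrite -[0](linear0 (lproj S)) -[v in X in _ <-> X]subr0; exact: lprojE. Qed.

(** Projectivity as the lifting property, in the form that does not require
    [g] to be surjective: it is enough that its range contains that of [f]. *)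
Definition projective {R : pzRingType} (P : lmodType R) :=
  forall (B C : lmodType R) (g : {linear B -> C}) (f : {linear P -> C}),
    (forall p, exists b, g b = f p) ->
    exists h : {linear P -> B}, forall p, g (h p) = f p.

Lemma projective_free {R : pzRingType} (T : choiceType) : projective (free R T).
Proof.
move=> B C g f gf; have [s sE] := choice (fun x => gf (fdelta R x)).
exists (lin_ext s) => p.
by apply: (@free_ext _ _ _ (g \o lin_ext s) f) => x /=; rewrite lin_ext_delta.
Qed.

Lemma projective_retract {R : pzRingType} (F P : lmodType R)
    (i : {linear P -> F}) (r : {linear F -> P}) :
  projective F -> cancel i r -> projective P.
Proof.
move=> Fproj irK B C g f gf.
have [h hE] := Fproj B C g (f \o r) (fun y => gf (r y)).
by exists (h \o i) => p /=; rewrite hE /= irK.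
Qed.

(** * Functoriality of the tensor product *)

Section TensorFunctoriality.
Context {R : comPzRingType}.

Lemma tensor_map_comp (A B C M N L : lmodType R) (g : {linear B -> C})
    (f : {linear A -> B}) (k : {linear N -> L}) (h : {linear M -> N}) t :
  tensor_map g k (tensor_map f h t) = tensor_map (g \o f) (k \o h) t.
Proof.
apply: (@tensor_ext _ _ _ _ (tensor_map g k \o tensor_map f h)) => a m.
by rewrite -[LHS]/(tensor_map _ _ (tensor_map _ _ _)) !tensor_mapE.
Qed.

Lemma eq_tensor_map (A B M N : lmodType R) (f f' : {linear A -> B})
    (h h' : {linear M -> N}) :
  f =1 f' -> h =1 h' -> tensor_map f h =1 tensor_map f' h'.
Proof. by move=> ff' hh'; apply: tensor_ext => a m; rewrite !tensor_mapE ff' hh'. Qed.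

Lemma tensor_map_id (A M : lmodType R) (f : {linear A -> A}) (h : {linear M -> M}) :
  f =1 id -> h =1 id -> tensor_map f h =1 id.
Proof.
move=> f1 h1; apply: (@tensor_ext _ _ _ _ _ idfun) => a m.
by rewrite tensor_mapE f1 h1.
Qed.

Lemma tens_is_linear (A M : lmodType R) (m : M) : linear (fun a : A => tens a m).
Proof. by move=> c a b; rewrite tensDl tensZl. Qed.

Lemma tensBl (A M : lmodType R) (a b : A) (m : M) :
  tens (a - b) m = tens a m - tens b m.
Proof. by rewrite tensDl -scaleN1r tensZl scaleN1r. Qed.

Lemma tens0r (A M : lmodType R) (a : A) : tens a (0 : M) = 0.
Proof. by rewrite -[0 in LHS](scale0r (0 : M)) tensZr scale0r. Qed.

Lemma tens0l (A M : lmodType R) (m : M) : tens (0 : A) m = 0.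
Proof. by rewrite -[0 in LHS](scale0r (0 : A)) tensZl scale0r. Qed.

Lemma tensor_map0 (A B M N : lmodType R) (f : {linear A -> B}) (h : {linear M -> N}) t :
  f =1 (fun=> 0) -> tensor_map f h t = 0.
Proof.
move=> f0; apply: (@tensor_ext _ _ _ _ (tensor_map f h) \0) => a m.
by rewrite tensor_mapE f0 tens0l.
Qed.

Lemma tensor_mapB (A B M N : lmodType R) (f g : {linear A -> B})
    (h : {linear M -> N}) t :
  tensor_map (f \- g) h t = tensor_map f h t - tensor_map g h t.
Proof.
apply: (@tensor_ext _ _ _ _ (tensor_map (f \- g) h)
  (tensor_map f h \- tensor_map g h)) => a m.
rewrite -[RHS]/(tensor_map _ _ _ - tensor_map _ _ _).
by rewrite !tensor_mapE tensBl.
Qed.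

Lemma tensor_mapN (A B M N : lmodType R) (f : {linear A -> B})
    (h : {linear M -> N}) t :
  tensor_map (\- f) h t = - tensor_map f h t.
Proof.
apply: (@tensor_ext _ _ _ _ (tensor_map (\- f) h) (\- tensor_map f h)) => a m.
rewrite -[RHS]/(- tensor_map _ _ _) !tensor_mapE.
by apply/eqP; rewrite -addr_eq0 -tensDl [_ + f a]addNr tens0l.
Qed.

End TensorFunctoriality.

(** * Comparison of a two-term complex with the canonical resolution *)

Section Comparison.
Context {R : comPzRingType} {P Q : lmodType R} (d : {linear P -> Q}).
Hypotheses (Pproj : projective P) (Qproj : projective Q).

Let A : lmodType R := lquot (lrange d).
Let F : nat -> lmodType R := res A.
Let delta n : {linear F n.+1 -> F n} := res_d A n.
Let pi : {linear Q -> A} := lproj (lrange d).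

Lemma lproj_lrange_eq0 q : lproj (lrange d) q = 0 -> exists p, d p = q.
Proof. by move=> /lproj_eq0/lrangeP. Qed.

Lemma lproj_lrange p : lproj (lrange d) (d p) = 0.
Proof. by apply/lproj_eq0/lrangeP; exists p. Qed.

Lemma augment_res_d (B : lmodType R) x : augment B (res_d B 0 x) = 0.
Proof. by apply/lkernelP; rewrite -res_exact0; apply/lrangeP; exists x. Qed.

Lemma res_dK (B : lmodType R) n x : res_d B n (res_d B n.+1 x) = 0.
Proof. by apply/lkernelP; rewrite -res_exact; apply/lrangeP; exists x. Qed.

(** A map from a projective module to the canonical resolution lifts through
    the differential as soon as it lands in the kernel of the next map. *)
Lemma res_lift0 (B P' : lmodType R) (f : {linear P' -> res B 0}) :
  projective P' -> (forall p, augment B (f p) = 0) ->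
  exists h : {linear P' -> res B 1}, forall p, res_d B 0 (h p) = f p.
Proof.
move=> P'proj f0; apply: P'proj => p; apply/lrangeP.
by rewrite res_exact0; apply/lkernelP.
Qed.

Lemma res_lift (B P' : lmodType R) n (f : {linear P' -> res B n.+1}) :
  projective P' -> (forall p, res_d B n (f p) = 0) ->
  exists h : {linear P' -> res B n.+2}, forall p, res_d B n.+1 (h p) = f p.
Proof.
move=> P'proj f0; apply: P'proj => p; apply/lrangeP.
by rewrite res_exact; apply/lkernelP.
Qed.

(** The comparison, lifting the identity of [A], between [P -> Q] and the bottom
    of the canonical resolution: chain maps [to0], [to1] to the resolution and
    [of0], [of1] back, and a homotopy [hpy0], [hpy1] in degree 1 from the
    identity of the resolution to the round trip. *)
Record comparison := Comparison {
  to0 : {linear Q -> F 0};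
  to1 : {linear P -> F 1};
  of0 : {linear F 0 -> Q};
  of1 : {linear F 1 -> P};
  hpy0 : {linear F 0 -> F 1};
  hpy1 : {linear F 1 -> F 2};
  augment_to0 : forall q, augment A (to0 q) = pi q;
  proj_of0 : forall x, pi (of0 x) = augment A x;
  to1_to0 : forall p, delta 0 (to1 p) = to0 (d p);
  of1_of0 : forall x, d (of1 x) = of0 (delta 0 x);
  hpy1E : forall x, delta 1 (hpy1 x) = to1 (of1 x) - x - hpy0 (delta 0 x) }.

Lemma comparison_exists : inhabited comparison.
Proof.
have [a0 a0E] : exists a0 : {linear Q -> F 0}, forall q, augment A (a0 q) = pi q.
  by apply: Qproj => q; exact: augment_surj.
have [a1 a1E] : exists a1 : {linear P -> F 1}, forall p, delta 0 (a1 p) = a0 (d p).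
  by apply: (@res_lift0 A P (a0 \o d)) => // p; exact: etrans (a0E _) (lproj_lrange _).
have [b0 b0E] : exists b0 : {linear F 0 -> Q}, forall x, pi (b0 x) = augment A x.
  apply: projective_free => x; exists (repr (augment A x)); exact: lproj_repr.
have [b1 b1E] : exists b1 : {linear F 1 -> P}, forall x, d (b1 x) = b0 (delta 0 x).
  apply: (@projective_free _ _ _ _ _ (b0 \o delta 0)) => x.
  by apply: lproj_lrange_eq0; rewrite /= [LHS]b0E augment_res_d.
have [h0 h0E] : exists h0 : {linear F 0 -> F 1},
    forall x, delta 0 (h0 x) = a0 (b0 x) - x.
  apply: (@res_lift0 A _ ((a0 \o b0) \- idfun)); first exact: projective_free.
  by move=> x; rewrite /= linearB /= a0E b0E subrr.
have [h1 h1E] : exists h1 : {linear F 1 -> F 2},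
    forall x, delta 1 (h1 x) = a1 (b1 x) - x - h0 (delta 0 x).
  apply: (@res_lift A _ 0 ((a1 \o b1) \- idfun \- (h0 \o delta 0))).
    exact: projective_free.
  (* The value to be lifted is a cycle: a1 and b1 commute with the
     differentials, and h0 is a homotopy in degree 0. *)
  move=> x; rewrite -[LHS]/(delta 0 (a1 (b1 x) - x - h0 (delta 0 x))).
  by rewrite 2!linearB a1E b1E h0E opprB addrA subrK subrr.
by split; exact: (Comparison a0E b0E a1E b1E h1E).
Qed.

Section TensorComparison.
Context (c : comparison) (M : lmodType R).
Let idM : {linear M -> M} := idfun.

Fact to1_to0_tensor t :
  tensor_map (to0 c) idM (tensor_map d idM t)
  = chain_d A M 1 (tensor_map (to1 c) idM t).
Proof.
rewrite -[RHS]/(tensor_map (delta 0) idM _) !tensor_map_comp.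
by apply: eq_tensor_map => // p /=; rewrite -to1_to0.
Qed.

(** The comparison in homology: a cycle of [P (x) M -> Q (x) M] is sent to the
    class of its image under [to1 (x) M]. *)
Definition tor1_map : {linear submod (lkernel (tensor_map d idM)) -> Tor 1 A M} :=
  lproj (boundaries (chain_d A M 2) (chain_d A M 1)) \o cycle_map to1_to0_tensor.

Fact of1_of0_tensor t :
  tensor_map (of0 c) idM (chain_d A M 1 t)
  = tensor_map d idM (tensor_map (of1 c) idM t).
Proof.
rewrite -[in LHS]/(tensor_map (delta 0) idM _) !tensor_map_comp.
by apply: eq_tensor_map => // p /=; rewrite -of1_of0.
Qed.

Lemma hpy1_tensor t :
  chain_d A M 2 (tensor_map (hpy1 c) idM t)
  = tensor_map (to1 c) idM (tensor_map (of1 c) idM t) - t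
    - tensor_map (hpy0 c) idM (chain_d A M 1 t).
Proof.
rewrite -[RHS]/(((tensor_map (to1 c) idM \o tensor_map (of1 c) idM) \- idfun
    \- (tensor_map (hpy0 c) idM \o tensor_map (delta 0) idM)) t).
rewrite -[LHS]/((tensor_map (delta 1) idM \o tensor_map (hpy1 c) idM) t).
apply: tensor_ext => x m.
rewrite -[LHS]/(tensor_map _ _ (tensor_map _ _ _)).
rewrite -[RHS]/(tensor_map _ _ (tensor_map _ _ _) - tens x m
   - tensor_map _ _ (tensor_map _ _ _)).
by rewrite !tensor_mapE hpy1E !tensBl.
Qed.

(** A preimage of the class of [z] is [(of1 (x) M) z]; by the homotopy its image
    differs from [z] by a boundary, since [z] is a cycle. *)
Lemma tor1_map_surj (t : Tor 1 A M) : exists z, tor1_map z = t.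
Proof.
rewrite -[t]lproj_repr; move: (repr t) => z.
have z0 : chain_d A M 1 (incl z) = 0 by apply/lkernelP; exact: valP z.
exists (cycle_map of1_of0_tensor z); apply/lprojE/lrangeP.
exists (tensor_map (hpy1 c) idM (incl z)).
by rewrite hpy1_tensor z0 linear0 subr0 linearB.
Qed.

Section Injective.
Hypothesis d_inj : forall p, d p = 0 -> p = 0.

Lemma of1_delta x : of1 c (delta 1 x) = 0.
Proof. by apply: d_inj; rewrite of1_of0 [delta 0 _]res_dK linear0. Qed.

(** The degree 1 half of a homotopy from the identity of [P -> Q] to the round
    trip through the resolution. *)
Lemma of1_to1 : exists s : {linear Q -> P},
  forall p, of1 c (to1 c p) = p + s (d p).
Proof.
have [s sE] : exists s : {linear Q -> P}, forall q, d (s q) = of0 c (to0 c q) - q.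
  apply: (@Qproj _ _ _ ((of0 c \o to0 c) \- idfun)) => q.
  apply: lproj_lrange_eq0; rewrite -[LHS]/(pi (of0 c (to0 c q) - q)).
  by rewrite linearB proj_of0 augment_to0 subrr.
exists s => p; apply/eqP; rewrite -subr_eq0; apply/eqP/d_inj.
by rewrite linearB linearD sE of1_of0 to1_to0 [d p + _]addrC subrK subrr.
Qed.

Lemma tor1_map_eq0 z : tor1_map z = 0 -> z = 0.
Proof.
move=> /lproj_eq0 /lrangeP[y yE]; apply: val_inj.
have dz0 : tensor_map d idM (incl z) = 0 by apply/lkernelP; exact: valP z.
have [s sE] := of1_to1.
have -> : val z = tensor_map (of1 c) idM (tensor_map (to1 c) idM (incl z))
                  - tensor_map s idM (tensor_map d idM (incl z)).
  rewrite !tensor_map_comp -tensor_mapB.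
  by apply/esym/tensor_map_id => // p /=; rewrite sE addrK.
rewrite dz0 linear0 subr0 -[tensor_map (to1 c) idM (incl z)]yE.
rewrite -[chain_d _ _ _]/(tensor_map (delta 1) idM) tensor_map_comp.
by apply: tensor_map0 => x /=; exact: of1_delta.
Qed.

Lemma tor1_map_inj : injective tor1_map.
Proof.
move=> z z' zz'; apply/eqP; rewrite -subr_eq0; apply/eqP/tor1_map_eq0.
by rewrite linearB zz' subrr.
Qed.

(** In degrees at least 2 the round trip is zero, so that the identity
    of the resolution is homotopic to zero there. *)
Lemma higher_homotopy n : exists (h : {linear F n.+1 -> F n.+2})
    (k : {linear F n.+2 -> F n.+3}),
  forall x, delta n.+2 (k x) = - x - h (delta n.+1 x).
Proof.
have liftP m (h : {linear F m.+1 -> F m.+2}) :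
    (forall x, delta m.+1 (h (delta m.+1 x)) = - delta m.+1 x) ->
    exists k : {linear F m.+2 -> F m.+3},
      forall x, delta m.+2 (k x) = - x - h (delta m.+1 x).
  move=> hE; apply: (@res_lift A _ m.+1 ((\- idfun) \- (h \o delta m.+1))).
    exact: projective_free.
  move=> x; rewrite -[LHS]/(delta m.+1 (- x - h (delta m.+1 x))).
  by rewrite linearB linearN hE subrr.
(* In degree 1 the round trip of a boundary is zero by of1_delta. *)
elim: n => [|n [h [k kE]]].
  exists (hpy1 c); apply: liftP => x.
  by rewrite hpy1E of1_delta linear0 [delta 0 _]res_dK linear0 subr0 sub0r.
exists k; apply: liftP => x.
by rewrite kE [delta n.+1 _]res_dK linear0 subr0.
Qed.

Lemma higher_tor_eq0 n (t : Tor n.+2 A M) : t = 0.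
Proof.
rewrite -[t]lproj_repr; move: (repr t) => z; apply/lproj_eq0/lrangeP.
have z0 : tensor_map (delta n.+1) idM (incl z) = 0.
  by apply/lkernelP; exact: valP z.
have [h [k kE]] := higher_homotopy n.
exists (- tensor_map k idM (incl z)); rewrite linearN.
rewrite -[chain_d _ _ _]/(tensor_map (delta n.+2) idM) tensor_map_comp.
rewrite (@eq_tensor_map _ _ _ _ _ _ ((\- idfun) \- (h \o delta n.+1)) _ idM) //.
rewrite tensor_mapB -[X in _ - X](tensor_map_comp h (delta n.+1) idM idM) z0.
rewrite linear0 subr0.
by rewrite tensor_mapN tensor_map_id ?opprK.
Qed.

End Injective.

End TensorComparison.

Lemma tor1_map_natural (c : comparison) (M N : lmodType R) (f : {linear M -> N}) z z' :
  incl z' = tensor_map idfun f (incl z) ->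
  Tor_map 1 A f (tor1_map c M z) = tor1_map c N z'.
Proof.
move=> z'E; rewrite [LHS]lquot_liftE; apply: (congr1 (lproj _)); apply: val_inj.
rewrite -[LHS]/(tensor_map idfun f (tensor_map (to1 c) idfun (incl z))).
rewrite -[RHS]/(tensor_map (to1 c) idfun (incl z')) z'E.
by rewrite !tensor_map_comp; apply: eq_tensor_map.
Qed.

End Comparison.

(** * Tensor products with a free module as finitely supported functions *)

Section TensorLift.
Context {R : comPzRingType} {A M N : lmodType R} (b : A -> M -> N).
Hypotheses (b_linl : forall m, linear (b^~ m)) (b_linr : forall a, linear (b a)).

Let h : {linear free R (A * M)%type -> N} := lin_ext (fun p => b p.1 p.2).

Fact tensor_lift_subproof t : t \in lspan (bilinear_rel (A:=A) (M:=M)) -> h t = 0.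
Proof.
have b0l m : b 0 m = 0.
  by have := b_linl m (-1) 0 0; rewrite scaleN1r oppr0 addr0 scaleN1r addNr.
have b0r a : b a 0 = 0.
  by have := b_linr a (-1) 0 0; rewrite scaleN1r oppr0 addr0 scaleN1r addNr.
move=> /asboolP/(_ (lkernel h)) ht; apply/eqP/ht => _ [] [x [y [z ->]]];
  apply/eqP; rewrite ?linearB ?linearZ /= !lin_ext_delta /=.
- by have := b_linl z 1 x y; rewrite !scale1r => ->; rewrite addrAC addrK subrr.
- by have := b_linr x 1 y z; rewrite !scale1r => ->; rewrite addrAC addrK subrr.
- by have := b_linl z x y 0; rewrite !addr0 b0l addr0 => ->; rewrite scalerN subrr.
- by have := b_linr y x z 0; rewrite !addr0 b0r addr0 => ->; rewrite scalerN subrr.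
Qed.

(** The linear map induced by a bilinear map. *)
Definition tensor_lift : {linear tensor A M -> N} := lquot_lift tensor_lift_subproof.

Lemma tensor_liftE a m : tensor_lift (tens a m) = b a m.
Proof. exact: etrans (lquot_liftE _ _) (lin_ext_delta _ _). Qed.

End TensorLift.

Section FreeTensor.
Context {R : comPzRingType} (T : choiceType) (M : lmodType R).

Fact coef_scale_fin_supp (p : free R T) (m : M) :
  (fun x => coef p x *: m) \in (fin_supp T M : {pred _}).
Proof.
apply/asboolP; apply: sub_finite_set (free_finite p) => x /= pm p0.
by apply: pm; rewrite p0 scale0r.
Qed.

(** The function [x |-> coef p x *: m], the coordinates of [tens p m]. *)
Definition coef_scale (p : free R T) (m : M) : submod (fin_supp T M) :=
  Submod (coef_scale_fin_supp p m).

Fact coef_scale_linl m : linear (coef_scale^~ m).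
Proof.
move=> a p q; apply: val_inj; apply/funext => x /=.
by rewrite coefD coefZ scalerDl -scalerA.
Qed.

Fact coef_scale_linr p : linear (coef_scale p).
Proof.
move=> a m n; apply: val_inj; apply/funext => x /=.
by rewrite scalerDr scalerA [coef p x * a]GRing.mulrC -scalerA.
Qed.

(** The coordinates of an element of [free R T (x) M] in the basis [T]. *)
Definition coords : {linear tensor (free R T) M -> submod (fin_supp T M)} :=
  tensor_lift coef_scale_linl coef_scale_linr.

Lemma coords_tens p m : coords (tens p m) = coef_scale p m.
Proof. exact: tensor_liftE. Qed.

Lemma inclP a (u v : submod (fin_supp T M)) x :
  incl (a *: u + v) x = a *: incl u x + incl v x.
Proof. by rewrite linearP. Qed.

Lemma fin_supp_finite (u : submod (fin_supp T M)) : finite_set [set x | incl u x <> 0].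
Proof. by case: u => u u_fin; exact: (asboolP _ u_fin). Qed.

(** The element of [free R T (x) M] with coordinates [u]. *)
Definition of_coords (u : submod (fin_supp T M)) : tensor (free R T) M :=
  \sum_(x \in [set: T]) tens (fdelta R x) (incl u x).

Lemma of_coordsE (D : {fset T}) (u : submod (fin_supp T M)) :
  (forall x, x \notin D -> incl u x = 0) ->
  of_coords u = \sum_(x <- D) tens (fdelta R x) (incl u x).
Proof. by move=> uD; apply: fsbigTE => x /uD ->; exact: tens0r. Qed.

Lemma support_notin (u : submod (fin_supp T M)) x :
  x \notin fset_set [set y | incl u y <> 0] -> incl u x = 0.
Proof.
by rewrite in_fset_set ?notin_setE; [move/contrapT | exact: fin_supp_finite].
Qed.

Fact of_coords_linear : linear of_coords.
Proof.
move=> a u v.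
pose D := [set x | incl u x <> 0] `|` [set x | incl v x <> 0].
have Dfin : finite_set D by rewrite finite_setU; split; exact: fin_supp_finite.
have notD x : x \notin fset_set D -> incl u x = 0 /\ incl v x = 0.
  rewrite in_fset_set// notin_setE /= => /not_orP[].
  by move=> /contrapT ? /contrapT.
rewrite !(@of_coordsE (fset_set D)).
- rewrite scaler_sumr -big_split; apply: eq_bigr => x _.
  by rewrite -tensZr -[RHS]tensDr inclP.
- by move=> x /notD[].
- by move=> x /notD[].
- by move=> x /notD[ux vx]; rewrite inclP ux vx scaler0 addr0.
Qed.

HB.instance Definition _ :=
  GRing.isLinear.Build R (submod (fin_supp T M)) (tensor (free R T) M) _
    of_coords of_coords_linear.

Lemma of_coordsK : cancel of_coords coords.
Proof.
move=> u; apply: val_inj; apply/funext => y.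
rewrite -[LHS]/(incl (coords _) y) -[RHS]/(incl u y).
pose D := fset_set [set x | incl u x <> 0].
have notD x : x \notin D -> incl u x = 0 by exact: support_notin.
rewrite (of_coordsE notD).
rewrite (linear_sum coords) (linear_sum (@incl _ _ (fin_supp T M))) fct_sumE.
rewrite (eq_bigr (fun x => (y == x)%:R *: incl u x)) => [|x _]; last first.
  by rewrite coords_tens.
have [yD|yD] := boolP (y \in D).
  rewrite (bigD1_seq y)//= big1 ?addr0 => [|x xy]; first by rewrite eqxx scale1r.
  by rewrite eq_sym (negPf xy) scale0r.
rewrite big_seq big1 => [|x xD]; first by rewrite notD.
have [yx|] := eqVneq y x; first by rewrite yx xD in yD.
by rewrite scale0r.
Qed.

Lemma coordsK : cancel coords of_coords.
Proof.
apply: (@tensor_ext _ _ _ _ (of_coords \o coords) idfun) => p m.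
rewrite -[LHS]/(of_coords (coords (tens p m))) coords_tens.
pose tm := tens^~ m : free R T -> tensor (free R T) M.
pose tmL : {linear free R T -> tensor (free R T) M} :=
  HB.pack tm (GRing.isLinear.Build R _ _ _ tm (tens_is_linear m)).
pose sm := coef_scale^~ m.
pose smL : {linear free R T -> submod (fin_supp T M)} :=
  HB.pack sm (GRing.isLinear.Build R _ _ _ sm (coef_scale_linl m)).
apply: (@free_ext _ _ _ (of_coords \o smL) tmL) => x.
rewrite -[LHS]/(of_coords (coef_scale (fdelta R x) m)).
rewrite (@of_coordsE [fset x]%fset) ?big_seq_fset1.
  by rewrite /= coef_delta eqxx scale1r.
by move=> y; rewrite inE /= coef_delta => /negPf ->; rewrite scale0r.
Qed.

End FreeTensor.

Arguments coords {R T M}.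

Lemma of_coords_natural {R : comPzRingType} (T : choiceType) (M N : lmodType R)
    (f : {linear M -> N}) (u : submod (fin_supp T M)) (v : submod (fin_supp T N)) :
  (forall x, incl v x = f (incl u x)) ->
  of_coords v = tensor_map idfun f (of_coords u).
Proof.
move=> vE; have uD := @support_notin _ _ _ u.
have vD x : x \notin fset_set [set y | incl u y <> 0] -> incl v x = 0.
  by move=> /uD ux; rewrite vE ux linear0.
rewrite (of_coordsE uD) (of_coordsE vD) (linear_sum (tensor_map _ _)).
by apply: eq_bigr => x _; rewrite tensor_mapE vE.
Qed.

(** * The Laplacian on tensors and on functions *)

Section NetworkLaplacian.
Context {R : comPzRingType} (G : network R).

(** The edges from [x] to [y] and those from [y] to [x] have the same total
    weight: edge reversal exchanges them. *)
Lemma sum_out_rev (x y : vertex G) :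
  \sum_(e \in out x) weight e * (y == target e)%:R
  = \sum_(e \in out y) weight e * (target e == x)%:R :> R.
Proof.
have rev_bij : set_bij [set: edge G] [set: edge G] (@rev G).
  split=> // [e e' _ _|e _]; first exact: (can_inj (@revK G)).
  by exists (rev e) => //; exact: revK.
rewrite fsbig_mkcond [RHS]fsbig_mkcond [RHS](reindex_fsbig (@rev G) setT)//.
apply: eq_fsbigr => e _; rewrite /patch.
have inE' (z : vertex G) e' : (e' \in out z) = (source e' == z).
  by apply/idP/eqP; rewrite inE.
rewrite !inE' source_rev weight_rev -[in RHS](source_rev (rev e)) revK.
rewrite [y == _]eq_sym.
by case: (source e == x); case: (target e == y); rewrite ?mulr0 ?mulr1.
Qed.

Section Functions.
Context (M : lmodType R).

(** The operator [laplacian_fun], named in order to declare it linear. *)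
Definition lap_fun : (vertex G -> M) -> (vertex G -> M) := @laplacian_fun R G M.

Fact lap_fun_linear : linear lap_fun.
Proof. by move=> a u v; apply/funext => x; exact: laplacian_funP. Qed.

HB.instance Definition _ :=
  GRing.isLinear.Build R (vertex G -> M) (vertex G -> M) _ lap_fun lap_fun_linear.
End Functions.

(** The Laplacian of the free module, transported to coefficient functions, is
    the Laplacian on functions, because its matrix is symmetric. *)
Lemma coef_laplacian (p : RV G) :
  incl (laplacian G p) = laplacian_fun (incl p : vertex G -> R^o).
Proof.
apply: (@free_ext _ _ _ (@incl _ _ (fin_supp _ R^o) \o laplacian G)
  (@lap_fun R^o \o @incl _ _ (fin_supp _ R^o))) => x.
rewrite -[LHS]/(incl (laplacian G (fdelta R x))).
rewrite -[RHS]/(laplacian_fun (incl (fdelta R x) : vertex G -> R^o)).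
rewrite [laplacian G _]lin_ext_delta; apply/funext => y.
rewrite /laplacian_fun linearD linearZ_LR.
rewrite -[LHS]/(potential x * (y == x)%:R + incl (\sum_(e \in out x)
   weight e *: (fdelta R x - fdelta R (target e))) y).
rewrite -[RHS]/(potential y * (y == x)%:R + \sum_(e \in out y)
   weight e * ((y == x)%:R - (target e == x)%:R)).
congr (_ + _); first by case: eqVneq => [->//|_]; rewrite !mulr0.
have finO z := @locally_finite G z.
rewrite [in LHS]fsbig_finite; last exact: finO.
rewrite (linear_sum (@incl _ _ (fin_supp _ R^o))) fct_sumE.
rewrite (eq_bigr (fun e => weight e * ((y == x)%:R - (y == target e)%:R)));
  last by move=> e _; rewrite linearZ linearB.
rewrite -fsbig_finite; last exact: finO.
have [->|xy] := eqVneq y x.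
  by apply: eq_fsbigr => e _; rewrite [x == _]eq_sym.
under eq_fsbigr do rewrite sub0r mulrN.
under [RHS]eq_fsbigr do rewrite sub0r mulrN.
have sumN z (f : edge G -> R) :
    \sum_(e \in out z) - f e = - \sum_(e \in out z) f e.
  by rewrite !(fsbig_finite _ _ (finO z)); exact: sumrN.
by rewrite !sumN sum_out_rev.
Qed.

Lemma coords_laplacian (M : lmodType R) (t : tensor (RV G) M) :
  incl (coords (tensor_map (laplacian G) idfun t))
  = laplacian_fun (incl (coords t)).
Proof.
apply: (@tensor_ext _ _ _ _ (@incl _ _ (fin_supp _ M) \o @coords _ _ M \o
    tensor_map (laplacian G) idfun)
  (@lap_fun M \o @incl _ _ (fin_supp _ M) \o @coords _ _ M)) => p m.
rewrite -[LHS]/(incl (coords (tensor_map (laplacian G) idfun (tens p m)))).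
rewrite -[RHS]/(laplacian_fun (incl (coords (tens p m)))).
rewrite tensor_mapE !coords_tens; apply/funext => y.
rewrite -[LHS]/(incl (laplacian G p) y *: m) coef_laplacian.
rewrite /laplacian_fun -/(out y) !fsbig_finite; try exact: (@locally_finite G y).
rewrite scalerDl -scalerA scaler_suml; congr (_ + _); apply: eq_bigr => e _.
by rewrite -scalerA scalerBl.
Qed.

End NetworkLaplacian.

(** * Finitely supported harmonic functions as a kernel on a tensor product *)

Section InnerModule.
Context {R : comPzRingType} (G : network R).

(** The free module on the interior vertices, as a submodule of [RV G]. *)
Definition inner_module : lmodType R := submod (@RV_inner R G).

Definition inner_incl : {linear inner_module -> RV G} := @incl _ _ (@RV_inner R G).

(** The restricted Laplacian, with cokernel [Upsilon G]. *)
Definition inner_laplacian : {linear inner_module -> RV G} := laplacian G \o inner_incl.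

Fact delta_inner (x : vertex G) : inner x -> fdelta R x \in @RV_inner R G.
Proof.
move=> ix; apply/asboolP => y by_; rewrite coef_delta.
by case: eqVneq => // yx; case: by_; rewrite yx.
Qed.

(** The basis vector at [x] if [x] is an interior vertex, and 0 otherwise. *)
Definition inner_delta (x : vertex G) : inner_module :=
  if pselect (inner x) is left ix then Submod (delta_inner ix) else 0.

Lemma inner_deltaE x : inner x -> inner_incl (inner_delta x) = fdelta R x.
Proof. by rewrite /inner_delta; case: pselect. Qed.

(** The projection of [RV G] that forgets the coefficients on the boundary. *)
Definition inner_proj : {linear RV G -> inner_module} := lin_ext inner_delta.

Lemma inner_proj_delta x : inner_proj (fdelta R x) = inner_delta x.
Proof. exact: lin_ext_delta. Qed.

Lemma inner_inclK : cancel inner_incl inner_proj.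
Proof.
move=> p; apply: val_inj.
rewrite -[LHS]/((inner_incl \o inner_proj) (inner_incl p)).
rewrite (@free_ext _ _ _ (inner_incl \o inner_proj) (lin_ext (inner_incl \o inner_delta)))
  => [|x]; last first.
  by rewrite [RHS]lin_ext_delta -[LHS]/(inner_incl (inner_proj _)) inner_proj_delta.
rewrite -[RHS](@free_ext _ _ _ (lin_ext (fdelta R)) idfun) => [|x]; last first.
  exact: lin_ext_delta.
apply: eq_fsbigr => x _ /=; have [ix|nix] := pselect (inner x).
  by rewrite inner_deltaE.
case: p => p /= /asboolP p0; by rewrite p0 ?scale0r.
Qed.

Lemma projective_inner_module : projective inner_module.
Proof. exact: projective_retract (@projective_free _ _) inner_inclK. Qed.

Lemma inner_laplacian_inj :
  (forall u : U0 G R^o, u = 0) -> forall p, inner_laplacian p = 0 -> p = 0.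
Proof.
move=> U00 p Lp0; apply: val_inj; apply: val_inj => /=.
have pU0 : incl (inner_incl p) \in @U0_pred R G R^o.
  apply/asboolP; split.
  - exact: free_finite.
  - by move=> x; rewrite -coef_laplacian [laplacian G _]Lp0 linear0.
  - by move=> x bx; case: p {Lp0} => p /= /asboolP; apply.
exact: (congr1 val (U00 (Submod pU0))).
Qed.

Section Coefficients.
Context (M : lmodType R).

Fact U0_fin_supp (u : U0 G M) : incl u \in (fin_supp (vertex G) M : {pred _}).
Proof. by case: u => u /= /asboolP[? _ _]; apply/asboolP. Qed.

(** [U0 G M] as a submodule of the finitely supported functions. *)
Definition U0_coords (u : U0 G M) : submod (fin_supp (vertex G) M) :=
  Submod (U0_fin_supp u).

Fact U0_coords_linear : linear U0_coords.
Proof.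
move=> a u v; apply: val_inj; rewrite -[LHS]/(incl (a *: u + v)).
by rewrite -[RHS]/(incl (a *: U0_coords u + U0_coords v)) !linearP.
Qed.

HB.instance Definition _ := GRing.isLinear.Build R (U0 G M)
  (submod (fin_supp (vertex G) M)) _ U0_coords U0_coords_linear.

Let idM : {linear M -> M} := idfun.

(** The element of [inner_module (x) M] whose coordinates are the values of
    [u] on the interior vertices. *)
Definition U0_tensor : {linear U0 G M -> tensor inner_module M} :=
  tensor_map inner_proj idM \o (@of_coords R (vertex G) M \o U0_coords).

(** Projecting to the interior loses nothing, as [u] vanishes on the boundary. *)
Lemma incl_U0_tensor u :
  tensor_map inner_incl idM (U0_tensor u) = of_coords (U0_coords u).
Proof.
rewrite -[U0_tensor u]/(tensor_map inner_proj idM (of_coords (U0_coords u))).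
rewrite tensor_map_comp (of_coordsE (@support_notin _ _ _ (U0_coords u))).
rewrite (linear_sum (tensor_map _ _)); apply: eq_bigr => x _.
rewrite tensor_mapE -[_ (fdelta R x)]/(inner_incl (inner_proj (fdelta R x))).
rewrite inner_proj_delta; have [ix|nix] := pselect (inner x).
  by rewrite inner_deltaE.
suff -> : incl (U0_coords u) x = 0 by rewrite /= !tens0r.
by case: u => u /= /asboolP[_ _]; apply.
Qed.

Fact laplacian_U0_tensor u : U0_tensor u \in lkernel (tensor_map inner_laplacian idM).
Proof.
apply/lkernelP; rewrite -[LHS](tensor_map_comp (laplacian G) inner_incl idM idM).
rewrite incl_U0_tensor; apply: (can_inj (@coordsK _ _ _)); apply: val_inj.
rewrite linear0 [LHS]coords_laplacian of_coordsK; apply/funext => x.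
by have /asboolP[_ Lu _] := valP u; exact: Lu.
Qed.

(** [U0 G M] as the kernel of [inner_laplacian (x) M]; the lemmas below show that
    this map is bijective and natural in [M]. *)
Definition U0_kernel (u : U0 G M) : submod (lkernel (tensor_map inner_laplacian idM)) :=
  Submod (laplacian_U0_tensor u).

Fact U0_kernel_linear : linear U0_kernel.
Proof.
move=> a u v; apply: val_inj; rewrite -[LHS]/(U0_tensor (a *: u + v)).
by rewrite -[RHS]/(incl (a *: U0_kernel u + U0_kernel v)) !linearP.
Qed.

HB.instance Definition _ := GRing.isLinear.Build R (U0 G M) _ _
  U0_kernel U0_kernel_linear.

Lemma U0_kernel_inj : injective U0_kernel.
Proof.
move=> u v /(congr1 (fun z => coords (tensor_map inner_incl idM (incl z)))).
rewrite -![incl (U0_kernel _)]/(U0_tensor _) !incl_U0_tensor !of_coordsK.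
by move=> /(congr1 val) uv; apply: val_inj.
Qed.

Lemma U0_kernel_surj z : exists u, U0_kernel u = z.
Proof.
have z0 : tensor_map inner_laplacian idM (incl z) = 0 by apply/lkernelP; exact: valP z.
pose w := coords (tensor_map inner_incl idM (incl z)).
have wU0 : incl w \in @U0_pred R G M.
  apply/asboolP; split; first exact: fin_supp_finite.
    move=> x; rewrite -coords_laplacian.
    by rewrite [tensor_map (laplacian G) _ _]tensor_map_comp [tensor_map _ _ _]z0 !linear0.
  move=> x bx; rewrite /w; move: (incl z) => t.
  (* Evaluation at a boundary vertex kills the image of inner_module (x) M. *)
  pose ev (v : vertex G -> M) := v x.
  have ev_linear : linear ev by [].
  pose evL : {linear (vertex G -> M) -> M} :=
    HB.pack ev (GRing.isLinear.Build R _ _ _ ev ev_linear).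
  apply: (@tensor_ext _ _ _ _ (evL \o @incl _ _ (fin_supp _ M) \o @coords _ _ M \o
    tensor_map inner_incl idM) \0) => p m.
  rewrite -[LHS]/(incl (coords (tensor_map inner_incl idM (tens p m))) x).
  rewrite tensor_mapE coords_tens /=.
  by case: p => p /= /asboolP ->; rewrite ?scale0r.
exists (Submod wU0); apply: val_inj.
rewrite -[LHS]/(tensor_map inner_proj idM (of_coords (U0_coords (Submod wU0)))).
have -> : U0_coords (Submod wU0) = w by exact: val_inj.
rewrite coordsK tensor_map_comp tensor_map_id //.
exact: inner_inclK.
Qed.

End Coefficients.

Lemma U0_kernel_natural (M N : lmodType R) (f : {linear M -> N}) (u : U0 G M) :
  incl (U0_kernel (U0_map f u)) = tensor_map idfun f (incl (U0_kernel u)).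
Proof.
rewrite -[LHS]/(tensor_map inner_proj idfun (of_coords (U0_coords (U0_map f u)))).
rewrite -[incl (U0_kernel u)]/(tensor_map inner_proj idfun (of_coords (U0_coords u))).
have -> : of_coords (U0_coords (U0_map f u))
    = tensor_map idfun f (of_coords (U0_coords u)).
  exact: of_coords_natural.
by rewrite !tensor_map_comp; apply: eq_tensor_map.
Qed.

End InnerModule.

(** * Tor modules of a network *)

Theorem proposition2p11 (R : comPzRingType) (G : network R) :
  ((forall u : U0 G R^o, u = 0) ->
     (exists phi : forall M : lmodType R, {linear U0 G M -> Tor 1 (Upsilon G) M},
        (forall M : lmodType R, bijective (phi M)) /\
        (forall (M N : lmodType R) (f : {linear M -> N}) (u : U0 G M),
           Tor_map 1 (Upsilon G) f (phi M u) = phi N (U0_map f u)))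
     /\ (forall (M : lmodType R) (j : nat), (1 < j)%N ->
           forall t : Tor j (Upsilon G) M, t = 0))
  /\
  (~ (forall u : U0 G R^o, u = 0) ->
     exists phi : forall M : lmodType R, {linear U0 G M -> Tor 1 (Upsilon G) M},
       (forall M : lmodType R, forall t : Tor 1 (Upsilon G) M,
          exists u : U0 G M, phi M u = t) /\
       (forall (M N : lmodType R) (f : {linear M -> N}) (u : U0 G M),
          Tor_map 1 (Upsilon G) f (phi M u) = phi N (U0_map f u))).
Proof.
have [c] := comparison_exists (inner_laplacian G) (@projective_inner_module R G)
  (@projective_free R (vertex G)).
pose phi M : {linear U0 G M -> Tor 1 (Upsilon G) M} :=
  tor1_map c M \o @U0_kernel R G M.
have phi_surj M t : exists u, phi M u = t.
  have [z <-] := tor1_map_surj c t; have [u <-] := U0_kernel_surj z.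
  by exists u.
have phi_natural (M N : lmodType R) (f : {linear M -> N}) (u : U0 G M) :
    Tor_map 1 (Upsilon G) f (phi M u) = phi N (U0_map f u).
  by apply: tor1_map_natural; exact: U0_kernel_natural.
(* The same map serves both parts; injectivity needs the vanishing of U0. *)
split=> [U00|_]; last by exists phi; split.
have L_inj := inner_laplacian_inj U00.
have RV_proj := @projective_free R (vertex G).
split; last by move=> M [|[|n]] // _ t; exact: (higher_tor_eq0 c L_inj).
exists phi; split=> // M; have [g gK] := choice (phi_surj M).
have phi_inj : injective (phi M).
  exact: inj_comp (tor1_map_inj RV_proj L_inj) (@U0_kernel_inj R G M).
by exists g => [u|t]; [apply: phi_inj; rewrite gK|exact: gK].
Qed.
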